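(* Let $X$ be a nonzero finite-dimensional real vector space with a norm $\|\cdot\|_0$ and unit sphere $S_0=\{u\in X:\|u\|_0=1\}$. Let $f:X\to\mathbb{R}$ be finite and convex, let $p_0\in\operatorname{dom} f^*\setminus\operatorname{ran}\partial f$, and put $$g(x)=f(x)-p_0(x)+f^*(p_0),\qquad \Psi(u)=f^\infty(u)-p_0(u)\ (u\in S_0),\qquad \mathcal U=\{u\in S_0:\Psi(u)=0\}.$$ Assume that $\Psi$ is finite and continuous on $S_0$, that $\mathcal U$ is nonempty, and that there exist $\nu>0$ and a continuous function $\kappa:S_0\to(0,\infty)$ such that $$\sup_{u\in S_0}\left|r^\nu\bigl(g(ru)-r\Psi(u)\bigr)-\kappa(u)\right|\longrightarrow 0\qquad(r\to\infty).$$ Let $h\in X^*$ satisfy $h(u)>0$ for every $u\in\mathcal U$. For $\mu>0$ set $p_\mu=p_0-\mu h$ and consider the problem $$m(\mu)=\inf_{x\in X}\{f(x)-p_\mu(x)+f^*(p_0)\}=\inf_{x\in X}\{g(x)+\mu h(x)\}.$$ On $\mathcal U$ define $M(u)=\kappa(u)^{1/(\nu+1)}h(u)^{\nu/(\nu+1)}$, and let $M_*=\min_{u\in\mathcal U}M(u)$ and $\mathcal U_*=\operatorname{argmin}_{u\in\mathcal U}M(u)$. Then there exists $\mu_0>0$ such that, for every $0<\mu<\mu_0$, the function $g+\mu h$ is coercive and the problem defining $m(\mu)$ has a nonempty compact set of minimizers. Let $x_\mu$ be any minimizer and, for sufficiently small $\mu$, set $r_\mu=\|x_\mu\|_0$ and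 $u_\mu=x_\mu/r_\mu$. Define $\alpha=\nu/(\nu+1)$ and $C_\nu=(\nu+1)\nu^{-\nu/(\nu+1)}$. Then, as $\mu\downarrow0$, $$m(\mu)\sim C_\nu M_*\,\mu^\alpha .$$ Moreover, $$\operatorname{dist}(u_\mu,\mathcal U_* )\longrightarrow0,\qquad \frac{\Psi(u_\mu)}{\mu}\longrightarrow0 .$$ Every sequence $\mu_j\downarrow0$ has a subsequence for which $u_{\mu_j}\to\bar u$ for some $\bar u\in\mathcal U_*$, and along any such subsequence $$\mu_j^{1/(\nu+1)}r_{\mu_j}\longrightarrow\left(\frac{\nu\kappa(\bar u)}{h(\bar u)}\right)^{1/(\nu+1)}.$$ In particular, if $\mathcal U_*=\{u_*\}$ is a singleton, then the whole family satisfies $$u_\mu\longrightarrow u_*,\qquad r_\mu\sim\left(\frac{\nu\kappa(u_* )}{h(u_* )}\right)^{1/(\nu+1)}\mu^{-1/(\nu+1)}.$$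
   Context: $f^*(p)=\sup_{z\in X}\{p(z)-f(z)\}$ is the Fenchel conjugate, $\operatorname{dom} f^*=\{p\in X^*: f^*(p)<+\infty\}$; $\partial f(z)=\{p\in X^*: f(y)\ge f(z)+p(y-z)\ \forall y\in X\}$ and $\operatorname{ran}\partial f=\bigcup_{z\in X}\partial f(z)$. The recession function is $f^\infty(w)=\lim_{\lambda\to\infty}\frac{f(z+\lambda w)-f(z)}{\lambda}\in\mathbb{R}\cup\{+\infty\}$ (independent of $z$). The distance $\operatorname{dist}$ is taken in the norm $\|\cdot\|_0$. A function is coercive if it tends to $+\infty$ as $\|x\|_0\to\infty$. $A(\mu)\sim B(\mu)$ means $A(\mu)/B(\mu)\to1$ as $\mu\downarrow0$. *)

(* Defs.v *)
From HB Require Import structures.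
From mathcomp Require Import all_boot all_order all_algebra.
From mathcomp Require Import all_classical all_reals all_analysis.

Set Implicit Arguments.
Unset Strict Implicit.
Unset Printing Implicit Defensive.
Import Order.TTheory GRing.Theory Num.Theory.
Import numFieldNormedType.Exports.

Local Open Scope classical_set_scope.
Local Open Scope ring_scope.

#[short(type="normedVectType")]
HB.structure Definition NormedVector (R : numFieldType) :=
  {V of NormedModule R V & Vector R V}.

Section ConvexAnalysis.
Context {R : realType} {X : normedVectType R}.
Implicit Types (f : X -> R) (p : 'Hom(X, R^o)) (x u w z : X).

Definition unit_sphere : set X := [set u | `|u| = 1].

Definition fenchel f p : \bar R := ereal_sup [set (p z - f z)%:E | z in setT].

Definition dom_fenchel f : set 'Hom(X, R^o) :=
  [set p | (fenchel f p < +oo)%E].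

Definition subdiff f z : set 'Hom(X, R^o) :=
  [set p | forall y, f y >= f z + p (y - z)].

Definition ran_subdiff f : set 'Hom(X, R^o) := \bigcup_z subdiff f z.

(* The base point of the difference quotient is [0]: for convex [f] the limit
   exists in [\bar R] and does not depend on the base point. *)
Definition recession f w : \bar R :=
  lim (((f (l *: w) - f 0) / l)%:E @[l --> +oo]).

Definition coercive (F : X -> R) :=
  forall A : R, exists B : R, forall x, B < `|x| -> A < F x.

Definition argmin (A : set X) (F : X -> R) : set X :=
  [set x | A x /\ forall y, A y -> F x <= F y].

(* [fenchel f p0] is a real number as soon as [p0] lies in [dom_fenchel f],
   [X] being nonempty and [f] finite. *)
Definition gap f p x : R := f x - p x + fine (fenchel f p).

Definition Psi f p u : \bar R := (recession f u - (p u)%:E)%E.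

Definition Psi_zero f p : set X := [set u | unit_sphere u /\ Psi f p u = 0%E].

Section Perturbed.
Variables (f : X -> R) (p0 h : 'Hom(X, R^o)).

Definition p_ (mu : R) : 'Hom(X, R^o) := p0 - mu *: h.

Definition objective (mu : R) x : R := f x - p_ mu x + fine (fenchel f p0).

Definition minval (mu : R) : \bar R :=
  ereal_inf [set (objective mu x)%:E | x in setT].

Definition minimizers (mu : R) : set X := argmin setT (objective mu).

Variables (nu : R) (kappa : X -> R).

Definition M u : R :=
  kappa u `^ (nu + 1)^-1 * h u `^ (nu / (nu + 1)).

(* A minimum when [Psi_zero f p0] is nonempty: that set is compact and [M] is
   continuous on it.  The real-valued [inf] is harmless since [M] is
   nonnegative. *)
Definition M_star : R := inf [set M u | u in Psi_zero f p0].

Definition U_star : set X := argmin (Psi_zero f p0) M.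

End Perturbed.
End ConvexAnalysis.

Definition C_ {R : realType} (nu : R) : R := (nu + 1) * nu `^ (- (nu / (nu + 1))).

(* [A mu ~ B mu] as [mu] decreases to [0]. *)
Definition equiv0 {R : realType} (A B : R -> R) :=
  A mu / B mu @[mu --> 0^'+] --> (1 : R).

(* Main.v *)
Require Import Defs.
From mathcomp Require Import all_boot all_order all_algebra.
From mathcomp Require Import all_classical all_reals all_analysis.
From mathcomp Require Import ring lra.
Import Order.TTheory GRing.Theory Num.Theory.
Import numFieldNormedType.Exports.

Local Open Scope classical_set_scope.
Local Open Scope ring_scope.

(* In polar coordinates [x = r u] put [t = mu^(1/(nu+1)) r]. The objective divided
   by [mu^(nu/(nu+1))] is then [t^(-nu) K + t W], where [W = Psi u / mu + h u] and
   [K] tends to [kappa u] uniformly in [u] as [r] tends to infinity. Its minimum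
   over [t] is [C_nu K^(1/(nu+1)) W^(nu/(nu+1))], and a nearly minimal value forces
   [t] to be near the minimizer. A trial point over [U_star] bounds the minimal
   value from above by [C_nu M_star + o(1)]. Since [W >= h u], this squeezes every
   cluster direction of the minimizers into [U_star] and forces [Psi u / mu] to
   [0]. *)

(** * Finite-dimensional normed spaces *)

(** The two conditions on [p0] act separately: finiteness of the conjugate makes the gap
    nonnegative, hence [Psi >= 0], while the absence of a point with subgradient [p0] makes it
    strictly positive, which drives the minimizers to infinity. The obstacle is that [Psi u / mu],
    hence [W], is not bounded a priori. The vanishing of [Psi] in the limit direction must therefore
    come first, from the estimate multiplied by [mu^(nu/(nu+1))]; only then can [M] be compared with
    its minimum and [W] be shown to converge to [h]. Limits are taken along an arbitrary proper
    filter finer than [0^'+] on which the directions converge. Convergent subsequences give such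
    filters, and so does every finer ultrafilter, by compactness of the sphere; a limit that holds
    along all these ultrafilters holds for the whole family. *)

Section FiniteDimension.
Context {R : realType}.
Import VectorInternalTheory.

Lemma le_norm_linear_continuous {V W : normedModType R} (L : {linear V -> W}) C :
  (forall v, `|L v| <= C * `|v|) -> continuous L.
Proof.
move=> hC; apply: bounded_linear_continuous; apply/linear_boundedP.
by near=> M => v; rewrite (le_trans (hC v))// ler_wpM2r.
Unshelve. all: end_near. Qed.

Lemma linear_rV_bounded {n} {V : normedModType R} (L : {linear 'rV[R]_n -> V}) :
  exists2 C : R, 0 < C & forall v, `|L v| <= C * `|v|.
Proof.
pose D := \sum_(i < n) `|L (delta_mx 0 i)|.
have D0 : 0 <= D by exact: sumr_ge0.
(* The summand [1] keeps the constant positive when [L] vanishes. *)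
exists (1 + D); first by rewrite ltr_wpDr.
move=> v; rewrite {1}[v]row_sum_delta linear_sum mulrDl mul1r.
rewrite (@le_trans _ _ (D * `|v|)) ?lerDr// mulr_suml.
apply: le_trans (ler_norm_sum _ _ _) _; apply: ler_sum => i _.
rewrite linearZ normrZ mulrC ler_wpM2l//.
rewrite [leRHS]/Num.norm /= mx_normrE; apply/bigmax_geP; right => /=.
by exists (0, i).
Qed.

Context {X : normedVectType R}.

(* The norm of [X] dominates the sup norm of the coordinates because it is
   positive and continuous on the compact unit sphere of the latter. *)
Lemma v2r_bounded : exists2 C : R, 0 < C & forall x : X, `|v2r x| <= C * `|x|.
Proof.
have [C C0 hC] := linear_rV_bounded (@r2v R X : {linear _ -> X}).
pose S : set 'rV[R]_(dim X) := [set v | `|v| = 1].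
have [S0|/set0P S0] := eqVneq S set0.
  exists 1 => // x; have [->|x0] := eqVneq x 0; first by rewrite linear0 !normr0 mulr0.
  have : S ((`|v2r x|)^-1 *: v2r x).
    rewrite /S/= normrZ normfV normr_id mulVf// normr_eq0.
    by rewrite -(inj_eq (@r2v_inj _ X)) v2rK linear0.
  by rewrite S0.
have cr : continuous (@r2v R X : _ -> X).
  exact: (le_norm_linear_continuous (@r2v R X : {linear _ -> X}) _ hC).
have cS : compact S.
  apply: bounded_closed_compact.
    by exists 1; split; [exact: num_real|move=> M M1 v /= ->; exact: ltW].
  apply: (@closed_comp _ _ (fun v : 'rV[R]_(dim X) => `|v|) [set 1]) => //.
    by move=> v _; exact: norm_continuous.
have cn : {within S, continuous (fun v => `|r2v v : X|)}.
  apply: continuous_subspaceT => v; apply: continuous_comp; first exact: cr.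
  exact: norm_continuous.
have [c cinS hc] := compact_EVT_min S0 cS cn.
have c0 : 0 < `|r2v c : X|.
  rewrite normr_gt0 -(inj_eq (@v2r_inj _ X)) r2vK linear0 -normr_eq0.
  by move: cinS; rewrite inE /S/= => ->; exact: oner_neq0.
exists (`|r2v c : X|)^-1; first by rewrite invr_gt0.
move=> x; have [->|x0] := eqVneq x 0; first by rewrite linear0 !normr0 mulr0.
have vx0 : 0 < `|v2r x| by rewrite normr_gt0 -(inj_eq (@r2v_inj _ X)) v2rK linear0.
have /hc : (`|v2r x|)^-1 *: v2r x \in S.
  by rewrite inE /S/= normrZ normfV normr_id mulVf// gt_eqF.
rewrite linearZ/= v2rK normrZ normfV normr_id.
by rewrite ler_pdivlMl// ler_pdivlMl// mulrC.
Qed.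

(** Heine-Borel is transported from coordinates: [A] is the image under [r2v] of its preimage, which
    is closed because [r2v] is continuous and bounded by [v2r_bounded]. *)
Lemma bounded_closed_compactV (A : set X) :
  bounded_set A -> closed A -> compact A.
Proof.
move=> bA cA.
have [C C0 hC] := linear_rV_bounded (@r2v R X : {linear _ -> X}).
have [D D0 hD] := v2r_bounded.
have cr : continuous (@r2v R X : _ -> X).
  exact: (le_norm_linear_continuous (@r2v R X : {linear _ -> X}) _ hC).
have -> : A = r2v @` (r2v @^-1` A).
  apply/seteqP; split => [x Ax|_ [v Av <-]//].
  by exists (v2r x) => //=; rewrite v2rK.
apply: continuous_compact; first exact: continuous_subspaceT.
apply: bounded_closed_compact.
  have [M [Mr MA]] := bA.
  exists (D * (M + 1)); split; first exact: num_real.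
  move=> N MN v /= Av.
  rewrite (le_trans _ (ltW MN))// -{1}(r2vK v) (le_trans (hD _))//.
  have M1 : M < M + 1 by rewrite ltrDl.
  by apply: ler_wpM2l; [exact: ltW|exact: (MA _ M1 _ Av)].
by apply: closed_comp => // v _; exact: cr.
Qed.

Lemma linear_functional_bounded (p : 'Hom(X, R^o)) :
  exists2 C : R, 0 < C & forall x, `|p x| <= C * `|x|.
Proof.
have [C C0 hC] := linear_rV_bounded (p \o @r2v R X : {linear _ -> R^o}).
have [D D0 hD] := v2r_bounded.
exists (C * D); first exact: mulr_gt0.
move=> x; rewrite -{1}(v2rK x) (le_trans (hC _))// -mulrA.
by rewrite ler_wpM2l// ltW.
Qed.

Lemma linear_functional_continuous (p : 'Hom(X, R^o)) :
  continuous (p : X -> R).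
Proof.
have [C C0 hC] := linear_functional_bounded p.
exact: (le_norm_linear_continuous (p : {linear X -> R^o}) _ hC).
Qed.

End FiniteDimension.

(** * Convex and coercive functions *)

Section ConvexContinuity.
Context {R : realType}.
Import VectorInternalTheory.

Lemma convex_functionP {V : lmodType R} (f : V -> R) :
  convex_function [set: V] f -> forall (t : R) (x y : V), 0 <= t <= 1 ->
  f (t *: x + (1 - t) *: y) <= t * f x + (1 - t) * f y.
Proof.
move=> cf t x y /andP[t0 t1].
have := cf (Itv01 t0 t1) x y.
rewrite !in_setT => /(_ isT isT).
exact.
Qed.

(** The point lies on the segment from [x] to [x + e] or to [x - e] according to the sign of [t];
    adding both absolute increments gives one constant for both signs. *)
Lemma convex_line_bound {V : lmodType R} (f : V -> R) (x e : V) :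
  convex_function [set: V] f ->
  exists2 c : R, 0 <= c & forall t : R, `|t| <= 1 -> f (x + t *: e) <= f x + c * `|t|.
Proof.
move=> /convex_functionP cf.
exists (`|f (x + e) - f x| + `|f (x - e) - f x|); first by rewrite addr_ge0.
move=> t t1; have [t0|t0] := leP 0 t.
  have tE : `|t| = t by rewrite ger0_norm.
  rewrite tE in t1 *.
  have -> : x + t *: e = t *: (x + e) + (1 - t) *: x.
    by rewrite scalerDr scalerBl scale1r [RHS]addrC addrA subrK.
  have /le_trans := cf t (x + e) x ltac:(by rewrite t0 t1); apply.
  have h1 := ler_norm (f (x + e) - f x); have h2 := normr_ge0 (f (x - e) - f x).
  nra.
have tE : `|t| = - t by rewrite ltr0_norm.
rewrite tE in t1 *.
have -> : x + t *: e = (- t) *: (x - e) + (1 - (- t)) *: x.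
  by rewrite scalerBr scalerBl scale1r !scaleNr !opprK [RHS]addrC addrA addrK.
have /le_trans := cf (- t) (x - e) x ltac:(apply/andP; split; lra); apply.
have h1 := ler_norm (f (x - e) - f x); have h2 := normr_ge0 (f (x + e) - f x).
nra.
Qed.

(** Induction on the directions: the point is the midpoint of a displacement along the first
    direction and one along the others, both with doubled coefficients. The doubling halves the
    admissible radius at each step and cancels against the weight [1/2], so the constants simply
    add. *)
Lemma convex_span_bound {V : lmodType R} {I : Type} (f : V -> R) (x : V)
    (e : I -> V) (s : seq I) :
  convex_function [set: V] f ->
  exists c d : R, [/\ 0 <= c, 0 < d & forall (t : I -> R) (tau : R), tau <= d ->
    (forall i, `|t i| <= tau) ->
    f (x + \sum_(i <- s) t i *: e i) <= f x + c * tau].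
Proof.
move=> cf; elim: s => [|i s [c [d [c0 d0 IH]]]].
  exists 0, 1; split => // t tau _ _.
  by rewrite big_nil addr0 mul0r addr0.
have [c' c'0 hc'] := convex_line_bound f x (e i) cf.
exists (c + c'), (Num.min d 1 / 2); split; first exact: addr_ge0.
  by rewrite divr_gt0// lt_min d0/=.
move=> t tau; rewrite ler_pdivlMr// le_min => /andP[taud tau1] ttau.
have /convex_functionP cf' := cf.
rewrite big_cons; set S := \sum_(j <- s) _.
have -> : x + (t i *: e i + S) =
    2^-1 *: (x + (2 * t i) *: e i) + (1 - 2^-1) *: (x + 2 *: S).
  have -> : 1 - 2^-1 = 2^-1 :> R by lra.
  rewrite -scalerDr addrACA -mulr2n -[x *+ 2]scaler_nat -scalerA -!scalerDr.
  by rewrite scalerA mulVf// scale1r.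
have /le_trans := cf' 2^-1 (x + (2 * t i) *: e i) (x + 2 *: S) ltac:(lra); apply.
have h2 : f (x + 2 *: S) <= f x + c * (2 * tau).
  rewrite scaler_sumr; under eq_bigr do rewrite scalerA.
  apply: IH => [|j]; first by rewrite mulrC.
  by rewrite normrM ger0_norm// ler_pM2l.
have tt := ttau i.
have h1 : f (x + (2 * t i) *: e i) <= f x + c' * (2 * tau).
  have t2 : `|2 * t i| <= 2 * tau by rewrite normrM ger0_norm// ler_pM2l.
  apply: le_trans (hc' (2 * t i) _) _; first by lra.
  by rewrite lerD2l ler_wpM2l.
lra.
Qed.

Context {X : normedVectType R}.

(** The coordinate basis gives a Lipschitz-type upper bound near [x]. Since [x] is the midpoint of
    [x + v] and [x - v], the upper bound at [- v] becomes a lower bound at [v]. *)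
Lemma convex_continuous (f : X -> R) :
  convex_function [set: X] f -> continuous f.
Proof.
move=> cf x; have [C C0 hC] := @v2r_bounded R X.
have [c [d [c0 d0 hcd]]] := convex_span_bound f x
  (fun i => r2v (delta_mx 0 i) : X) (index_enum 'I_(dim X)) cf.
have up v : C * `|v| <= d -> f (x + v) <= f x + c * (C * `|v|).
  move=> vd; rewrite -{1}(v2rK v) {1}[v2r v]row_sum_delta linear_sum.
  under eq_bigr do rewrite linearZ/=.
  apply: hcd => // i; apply: le_trans (hC v).
  rewrite [leRHS]/Num.norm /= mx_normrE; apply/bigmax_geP; right => /=.
  by exists (0, i).
have lo v : C * `|v| <= d -> f x - c * (C * `|v|) <= f (x + v).
  move=> vd; have /convex_functionP/(_ 2^-1 (x + v) (x - v)) := cf.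
  have -> : 1 - 2^-1 = 2^-1 :> R by lra.
  rewrite -scalerDr addrACA subrr addr0 -mulr2n -[x *+ 2]scaler_nat scalerA mulVf//.
  rewrite scale1r => /(_ ltac:(lra)).
  have := up (- v); rewrite normrN => /(_ vd).
  lra.
have n0 : `|v| @[v --> (0 : X)] --> (0 : R).
  by have := @norm_continuous R X 0; rewrite /continuous_at normr0.
have cont1 : C * `|v| @[v --> (0 : X)] --> (0 : R).
  by rewrite -(mulr0 C); exact: cvgMr.
have cont0 : c * (C * `|v|) @[v --> (0 : X)] --> (0 : R).
  by rewrite -(mulr0 c); exact: cvgMr.
have fx : f (x + v) @[v --> (0 : X)] --> f x.
  apply/cvgrPdist_le => e e0; near=> v.
  have vd : C * `|v| <= d by near: v; exact: cvgr_le cont1 _ d0.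
  have ve : c * (C * `|v|) <= e by near: v; exact: cvgr_le cont0 _ e0.
  have h1 := up v vd; have h2 := lo v vd.
  rewrite ler_norml; apply/andP; split; lra.
have -> : f = (fun v => f (x + v)) \o (fun y => y - x).
  by apply/funext => y /=; rewrite addrC subrK.
rewrite /continuous_at /= addrC subrK; apply: cvg_comp fx.
by rewrite -(subrr x); apply: cvgB => //; exact: cvg_cst.
Unshelve. all: end_near. Qed.

Lemma closed_ball_compact (B : R) : compact [set x : X | `|x| <= B].
Proof.
apply: bounded_closed_compactV.
  exists B; split; first exact: num_real.
  by move=> M BM x /= /le_trans -> //; exact: ltW.
apply: (@closed_comp _ _ (fun x : X => `|x|) [set r | r <= B]) => //.
  by move=> v _; exact: norm_continuous.
Qed.

Lemma unit_sphere_compact : compact (@unit_sphere R X).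
Proof.
apply: bounded_closed_compactV.
  exists 1; split; first exact: num_real.
  by move=> M BM x /= ->; exact: ltW.
apply: (@closed_comp _ _ (fun x : X => `|x|) [set 1]) => //.
by move=> v _; exact: norm_continuous.
Qed.

Lemma unit_sphere_closed : closed (@unit_sphere R X).
Proof. exact: compact_closed (@norm_hausdorff _ _) unit_sphere_compact. Qed.

Lemma coercive_argmin (F : X -> R) : continuous F -> coercive F ->
  argmin setT F !=set0 /\ compact (argmin setT F).
Proof.
move=> cF coF; have [B hB] := coF (F 0).
(* The maximum with [0] puts the origin into [K] even if [B] is negative. Outside [K] the values
   exceed [F 0], so a minimum over [K] is global. *)
pose K : set X := [set x | `|x| <= Num.max B 0].
have K0 : K 0 by rewrite /K/= normr0 le_max lexx orbT.
have [c cK hc] := compact_EVT_min (ex_intro _ _ K0)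
  (closed_ball_compact (Num.max B 0)) (continuous_subspaceT cF).
have cmin y : F c <= F y.
  have [/mem_set/hc//|/negP] := pselect (K y).
  rewrite -ltNge gt_max => /andP[/hB + _]; move/ltW; apply: le_trans.
  exact/hc/mem_set.
split; first by exists c.
apply: (subclosed_compact _ (closed_ball_compact (Num.max B 0))).
  rewrite (_ : argmin _ _ = F @^-1` [set r | r <= F c]).
    by apply: closed_comp => // v _; exact: cF.
  apply/seteqP; split => [x [_ xm]|x /= xm]; first exact: xm.
  by split => // y _; exact: le_trans xm _.
move=> x [_ xm]; rewrite /= leNgt gt_max; apply/negP => /andP[/hB + _].
by rewrite ltNge xm.
Qed.

End ConvexContinuity.

(** * The one-dimensional profile *)

Section Profile.
Context {R : realType}.
Implicit Types (nu t K W : R).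

Lemma cvg_ln {T : Type} {F : set_system T} {FF : Filter F} (f : T -> R) (l : R) :
  0 < l -> f x @[x --> F] --> l -> ln (f x) @[x --> F] --> ln l.
Proof. by move=> l0 fl; apply: (cvg_comp _ _ fl); exact: continuous_ln. Qed.

Lemma cvg_expR {T : Type} {F : set_system T} {FF : Filter F} (f : T -> R) (l : R) :
  f x @[x --> F] --> l -> expR (f x) @[x --> F] --> expR l.
Proof. by move=> fl; apply: (cvg_comp _ _ fl); exact: continuous_expR. Qed.

Lemma powR_expR (x a : R) : 0 < x -> x `^ a = expR (a * ln x).
Proof. by move=> x0; rewrite /powR gt_eqF. Qed.

Lemma cvg_powR {T : Type} {F : set_system T} {FF : Filter F} (f : T -> R) (l a : R) :
  0 < l -> f x @[x --> F] --> l -> f x `^ a @[x --> F] --> l `^ a.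
Proof.
move=> l0 fl; rewrite powR_expR//.
apply: cvg_trans (cvg_expR _ _ (cvgMl_tmp (a := a) (cvg_ln _ _ l0 fl))).
apply: near_eq_cvg; near=> x; rewrite powR_expR//.
by near: x; exact: cvgr_gt fl _ l0.
Unshelve. all: end_near. Qed.

(** Quantitative strict convexity of the exponential at [0]. A gap below [1] forces [y > -2], and
    then squaring [1 + y/2 <= exp (y/2)] bounds the gap below by [y^2/4]. *)
Lemma expR_gap_small (y e : R) : 0 < e ->
  expR y - 1 - y < Num.min 1 (e ^+ 2 / 4) -> `|y| < e.
Proof.
move=> e0; rewrite lt_min => /andP[h1 h2].
have y2 : -2 < y by have := expR_gt0 y; lra.
have hq : 1 + y + y ^+ 2 / 4 <= expR y.
  have -> : expR y = expR (y / 2) ^+ 2 by rewrite -expRM_natl; congr expR; lra.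
  have -> : 1 + y + y ^+ 2 / 4 = (1 + y / 2) ^+ 2 by field.
  by rewrite ler_sqr ?nnegrE ?expR_ge0 ?expR_ge1Dx//; lra.
by rewrite -ltr_sqr ?nnegrE ?normr_ge0 ?ltW// real_normK ?num_real//; lra.
Qed.

(** Logarithm of the ratio of [t] to the optimal radius [(nu K / W)^(1/(nu+1))], so that it vanishes
    exactly at the minimizer. *)
Definition profile_log nu t K W := ln t - (nu + 1)^-1 * (ln nu + ln K - ln W).

(* The substitution [t = exp y (nu K / W)^(1/(nu+1))] turns the reduced
   one-dimensional objective into a multiple of [exp (- nu y) + nu exp y]. *)
Lemma profileE nu t K W : 0 < nu -> 0 < t -> 0 < K -> 0 < W ->
  t `^ (- nu) * K + t * W =
  nu `^ (- (nu / (nu + 1))) * (K `^ (nu + 1)^-1 * W `^ (nu / (nu + 1))) *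
  (expR (- nu * profile_log nu t K W) + nu * expR (profile_log nu t K W)).
Proof.
move=> nu0 t0 K0 W0; rewrite /profile_log !powR_expR//.
rewrite mulrDr; congr (_ + _).
  by rewrite -{1}[K]lnK ?posrE// -!expRD; congr expR; field; lra.
rewrite mulrCA -{1}[t]lnK ?posrE// -{1}[W]lnK ?posrE// -{1}[nu]lnK ?posrE//.
by rewrite -!expRD; congr expR; field; lra.
Qed.

(** In the bracket of [profileE] only the first exponential is replaced by its tangent,
    [exp (- nu y) >= 1 - nu y]. What remains is [nu + 1] plus [nu] times the convexity gap of [exp]
    at [y], an excess that measures the distance to the minimizer. *)
Lemma profile_ge nu t K W : 0 < nu -> 0 < t -> 0 < K -> 0 < W ->
  C_ nu * (K `^ (nu + 1)^-1 * W `^ (nu / (nu + 1)))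
    * (1 + nu / (nu + 1) * (expR (profile_log nu t K W) - 1 - profile_log nu t K W))
  <= t `^ (- nu) * K + t * W.
Proof.
move=> nu0 t0 K0 W0; rewrite profileE// /C_; set y := profile_log nu t K W.
rewrite -!mulrA mulrCA ler_pM2l ?powR_gt0//.
rewrite mulrCA ler_pM2l ?powR_gt0// mulrCA ler_pM2l ?powR_gt0//.
have h := expR_ge1Dx (- nu * y).
have -> : (nu + 1) * (1 + nu * ((nu + 1)^-1 * (expR y - 1 - y))) =
  nu + 1 + nu * (expR y - 1 - y) by field; lra.
lra.
Qed.

Lemma young_profile nu t K W : 0 < nu -> 0 < t -> 0 < K -> 0 < W ->
  C_ nu * (K `^ (nu + 1)^-1 * W `^ (nu / (nu + 1))) <= t `^ (- nu) * K + t * W.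
Proof.
move=> nu0 t0 K0 W0; apply: le_trans (profile_ge _ _ _ _ nu0 t0 K0 W0).
rewrite ler_peMr//.
  by rewrite /C_ !mulr_ge0 ?powR_ge0//; lra.
rewrite lerDl mulr_ge0 ?divr_ge0//; try lra.
by have := expR_ge1Dx (profile_log nu t K W); lra.
Qed.

Lemma profile_min nu K W : 0 < nu -> 0 < K -> 0 < W ->
  let t := (nu * K / W) `^ (nu + 1)^-1 in
  t `^ (- nu) * K + t * W = C_ nu * (K `^ (nu + 1)^-1 * W `^ (nu / (nu + 1))).
Proof.
move=> nu0 K0 W0 t; have q0 : 0 < nu * K / W by rewrite divr_gt0 ?mulr_gt0.
have t0 : 0 < t by rewrite powR_gt0.
rewrite profileE//.
have -> : profile_log nu t K W = 0.
  rewrite /profile_log /t ln_powR ln_div ?posrE ?mulr_gt0// lnM ?posrE//.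
  by rewrite subrr.
by rewrite mulr0 expR0 /C_; lra.
Qed.

Lemma profile_gap_le nu (q v : R) : 0 < nu ->
  1 + nu / (nu + 1) * q <= v -> q <= (v - 1) * ((nu + 1) / nu).
Proof.
move=> nu0 h; have -> : q = (nu / (nu + 1) * q) * ((nu + 1) / nu) by field; lra.
by rewrite ler_wpM2r ?divr_ge0//; lra.
Qed.

Lemma C_gt0 nu : 0 < nu -> 0 < C_ nu.
Proof. by move=> nu0; rewrite mulr_gt0 ?powR_gt0// addr_gt0. Qed.

(** The value [V] and the optimal value [D] for the same [K] and [W] have the same positive limit.
    Hence [V / D] tends to [1], the excess in [profile_ge] tends to [0], and so does the logarithmic
    deviation of [t] from the optimum. *)
Lemma profile_stable {T : Type} {F : set_system T} {FF : ProperFilter F} nu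
    (t K W : T -> R) (k w : R) :
  0 < nu -> 0 < k -> 0 < w -> (\forall x \near F, 0 < t x) ->
  K x @[x --> F] --> k -> W x @[x --> F] --> w ->
  (t x `^ (- nu) * K x + t x * W x) @[x --> F] -->
    C_ nu * (k `^ (nu + 1)^-1 * w `^ (nu / (nu + 1))) ->
  t x @[x --> F] --> (nu * k / w) `^ (nu + 1)^-1.
Proof.
move=> nu0 k0 w0 tF Kk Ww VF.
pose y x := profile_log nu (t x) (K x) (W x).
pose D x := C_ nu * (K x `^ (nu + 1)^-1 * W x `^ (nu / (nu + 1))).
pose V x := t x `^ (- nu) * K x + t x * W x.
pose d := C_ nu * (k `^ (nu + 1)^-1 * w `^ (nu / (nu + 1))).
have C0 := C_gt0 _ nu0.
have d0 : 0 < d := mulr_gt0 C0 (mulr_gt0 (powR_gt0 _ k0) (powR_gt0 _ w0)).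
have Dd : D x @[x --> F] --> d.
  by apply: cvgMl_tmp; apply: cvgM; exact: cvg_powR.
have DV : (V x / D x - 1) * ((nu + 1) / nu) @[x --> F] --> (0 : R).
  have -> : 0 = (d / d - 1) * ((nu + 1) / nu) by rewrite divff ?gt_eqF// subrr mul0r.
  apply: cvgMr_tmp; apply: cvgB; last exact: cvg_cst.
  by apply: cvgM => //; apply: cvgV => //; rewrite gt_eqF.
have qF : \forall x \near F, expR (y x) - 1 - y x <= (V x / D x - 1) * ((nu + 1) / nu).
  near=> x.
  have t0 : 0 < t x by near: x.
  have K0 : 0 < K x by near: x; exact: cvgr_gt Kk _ k0.
  have W0 : 0 < W x by near: x; exact: cvgr_gt Ww _ w0.
  have D0 : 0 < D x := mulr_gt0 C0 (mulr_gt0 (powR_gt0 _ K0) (powR_gt0 _ W0)).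
  have := profile_ge _ _ _ _ nu0 t0 K0 W0.
  rewrite -/(y x) -/(V x) -/(D x) mulrC -ler_pdivlMr//.
  set q := expR _ - _ - _.
  exact: profile_gap_le.
have y0 : y x @[x --> F] --> (0 : R).
  apply/cvgr0Pnorm_lt => e e0.
  have m0 : 0 < Num.min 1 (e ^+ 2 / 4).
    by rewrite lt_min ltr01/= divr_gt0 ?exprn_gt0.
  near=> x.
  apply: expR_gap_small => //.
  have h : (V x / D x - 1) * ((nu + 1) / nu) < Num.min 1 (e ^+ 2 / 4).
    by near: x; exact: cvgr_lt DV _ m0.
  by apply: le_lt_trans h; near: x.
have kw0 : 0 < nu * k / w by rewrite divr_gt0 ?mulr_gt0.
have L : expR (y x + (nu + 1)^-1 * (ln nu + ln (K x) - ln (W x))) @[x --> F] -->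
    expR (0 + (nu + 1)^-1 * (ln nu + ln k - ln w)).
  apply: cvg_expR; apply: cvgD => //; apply: cvgMl_tmp; apply: cvgB; last exact: cvg_ln.
  by apply: cvgD; [exact: cvg_cst|exact: cvg_ln].
rewrite powR_expR// ln_div ?posrE ?mulr_gt0// lnM ?posrE// -[_ * _]add0r.
apply: cvg_trans L; apply: near_eq_cvg; near=> x.
by rewrite /y /profile_log subrK lnK// posrE; near: x.
Unshelve. all: end_near. Qed.

Lemma powR_conj nu (mu : R) : 0 < nu -> 0 < mu ->
  mu `^ (nu / (nu + 1)) * mu `^ (nu + 1)^-1 = mu.
Proof.
move=> nu0 mu0; rewrite -powRD; last by rewrite (gt_eqF mu0) implybT.
have -> : nu / (nu + 1) + (nu + 1)^-1 = 1 by field; lra.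
by rewrite powRr1// ltW.
Qed.

(* [g] and [g - r p] stand for the objective at [x = r u] and its deviation
   from the recession part [p]; [q] is the perturbing slope. *)
Lemma rescaled_objective nu (mu r g p q : R) : 0 < nu -> 0 < mu -> 0 < r ->
  (mu `^ (nu + 1)^-1 * r) `^ (- nu) * (r `^ nu * (g - r * p)) +
    mu `^ (nu + 1)^-1 * r * (p / mu + q) =
  (g + mu * (r * q)) / mu `^ (nu / (nu + 1)).
Proof.
move=> nu0 mu0 r0.
rewrite powRN powRM ?powR_ge0 ?ltW// -powRrM [_^-1 * nu]mulrC.
rewrite -{3 4}(powR_conj nu mu nu0 mu0).
have := powR_gt0 (nu / (nu + 1)) mu0; set A := mu `^ _ => A0.
have := powR_gt0 (nu + 1)^-1 mu0; set B := mu `^ _ => B0.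
have := powR_gt0 nu r0; set N := r `^ _ => N0.
by field; rewrite !gt_eqF.
Qed.

Lemma powR_cvgry (a : R) : 0 < a -> mu `^ (- a) @[mu --> 0^'+] --> +oo.
Proof.
move=> a0; have pF : \forall mu \near (0 : R)^'+, 0 < mu `^ a.
  by near=> mu; apply: powR_gt0; near: mu; exact: nbhs_right_gt.
have -> : (fun mu : R => mu `^ (- a)) = (fun mu : R => (mu `^ a)^-1).
  by apply/funext => mu; rewrite powRN.
exact: (cvgrVy pF).2 (powR_cvg0 a0).
Unshelve. all: end_near. Qed.

End Profile.

(** * Filters and compactness *)

Section Topology.

Lemma cvg_within_continuous {T : Type} {Y Z : topologicalType} (A : set Y)
    (phi : Y -> Z) (F : set_system T) (FF : Filter F) (u : T -> Y) (l : Y) :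
  {within A, continuous phi} -> A l -> (\forall s \near F, A (u s)) ->
  u s @[s --> F] --> l -> phi (u s) @[s --> F] --> phi l.
Proof.
move=> /subspace_continuousP/(_ l) phic Al uA ul.
apply: (cvg_comp u phi) (phic Al).
move=> B; rewrite /within/= nbhs_filterE => lB.
have uB : \forall s \near F, A (u s) -> B (u s) by exact: (ul _ lB).
by apply: filterS2 uA uB => s As; apply.
Qed.

Lemma cvg_ultra {T : Type} {Y : topologicalType} (F : set_system T)
    (FF : ProperFilter F) (phi : T -> Y) (l : Y) :
  (forall G : set_system T, UltraFilter G -> F `<=` G ->
     phi s @[s --> G] --> l) ->
  phi s @[s --> F] --> l.
Proof.
move=> H A lA; apply: contrapT => nFA.
pose B := ~` (phi @^-1` A).
have PW : ProperFilter (within B F).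
  apply: Build_ProperFilter => WB; apply: nFA.
  suff : F (phi @^-1` A) by [].
  have {}WB : F [set s | B s -> False] := WB.
  by apply: filterS WB => s Bs; apply: contrapT => /Bs.
have [G [UG WG]] := ultraFilterLemma PW.
have FG : F `<=` G.
  by move=> E FE; apply: WG; apply: filterS FE.
have GA : G (phi @^-1` A) := H G UG FG A lA.
have GB : G B by apply: WG; exact: withinT.
have [s [As Bs]] := filter_ex (filterI GA GB); exact: Bs As.
Qed.

(** Compactness yields a cluster point, and an ultrafilter converges to each of its cluster points
    because it contains every set or its complement. *)
Lemma ultra_compact_cvg {T : Type} {Y : topologicalType} (G : set_system T)
    (UG : UltraFilter G) (A : set Y) (u : T -> Y) :
  compact A -> (\forall s \near G, A (u s)) ->
  exists2 l, A l & u s @[s --> G] --> l.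
Proof.
move=> cA uA; have [l [Al cl]] := cA (u s @[s --> G]) _ uA.
exists l => // B lB.
have [//|GC] := in_ultra_setVsetC (u @^-1` B) UG.
by have [y []] := cl (~` B) B GC lB.
Qed.

(** The extraction is made on the real sequence of distances to [l], of which [0] is a cluster
    point. *)
Lemma cluster_subsequence {R : realType} {V : normedModType R} (v : nat -> V) (l : V) :
  cluster (v j @[j --> \oo]) l ->
  exists2 s : nat -> nat, {homo s : i j / (i < j)%N} & v (s j) @[j --> \oo] --> l.
Proof.
move=> cl.
have [s s_incr sl] : exists2 s : nat -> nat, {mono s : n m / (n <= m)%O} &
    (fun j => `|v j - l|) \o s @ \oo --> (0 : R).
  apply/cluster_eventually_cvg => A B FA B0.
  have lB : nbhs l [set y | B `|y - l|].
    have : `|y - l| @[y --> l] --> (0 : R).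
      rewrite -(@normr0 _ V) -(subrr l); apply: cvg_norm.
      by apply: cvgB; [exact: cvg_id|exact: cvg_cst].
    exact.
  by have [y [Ay By]] := cl [set y | A `|y - l|] _ FA lB; exists `|y - l|.
exists s => [i j ij|].
  by have := leqW_mono s_incr i j; rewrite /= => ->.
apply/subr_cvg0/cvgr0Pnorm_lt => e e0; move/cvgr0Pnorm_lt/(_ e e0): sl.
by apply: filterS => j /=; rewrite normr_id.
Qed.

Lemma homo_cvg_infty (s : nat -> nat) : {homo s : i j / (i < j)%N} ->
  s j @[j --> \oo] --> \oo.
Proof.
move=> hs A [N _ NA]; exists N => // j /= Nj; apply: NA => /=.
have js : (j <= s j)%N.
  by elim: (j) => // k kk; apply: leq_ltn_trans kk _; exact: hs.
exact: leq_trans Nj js.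
Qed.

Lemma pos_cvg_at_right {R : realType} (v : nat -> R) :
  (forall j, 0 < v j) -> v j @[j --> \oo] --> (0 : R) ->
  v j @[j --> \oo] --> 0^'+.
Proof.
move=> v0 vF A A0; have H : \forall j \near \oo, 0 < v j -> A (v j) := vF _ A0.
by apply: filterS H => j Aj; exact: Aj (v0 j).
Qed.

End Topology.

(** * Perturbed minimization *)

Section Perturbation.
Context {R : realType} {X : normedVectType R}.
Context (f : X -> R) (f_convex : convex_function [set: X] f).
Context (p0 : 'Hom(X, R^o)) (p0P : (dom_fenchel f `\` ran_subdiff f) p0).

Lemma unit_sphere_normalize (x : X) : x != 0 -> unit_sphere (`|x|^-1 *: x).
Proof.
by move=> x0; rewrite /unit_sphere/= normrZ normfV normr_id mulVf// normr_eq0.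
Qed.

Lemma gap_continuous : continuous (gap f p0).
Proof.
move=> x; apply: cvgD; last exact: cvg_cst.
apply: cvgB; first exact: convex_continuous.
exact: linear_functional_continuous.
Qed.

(** This is the Fenchel-Young inequality. The conjugate is finite: above because [p0] is in its
    domain, below by its value at [z = 0]. *)
Lemma gap_ge0 (x : X) : 0 <= gap f p0 x.
Proof.
have [pd _] := p0P; rewrite /dom_fenchel/= in pd.
have ub z : ((p0 z - f z)%:E <= fenchel f p0)%E by apply: ereal_sup_ubound; exists z.
have : fenchel f p0 \is a fin_num.
  by rewrite fin_numE -ltNye -ltey pd (lt_le_trans (ltNyr _) (ub 0)).
by move=> /fineK fE; have := ub x; rewrite -fE lee_fin /gap; lra.
Qed.

(** Equality in Fenchel-Young at [x] would make [p0] a subgradient of [f] at [x]. *)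
Lemma gap_gt0 (x : X) : 0 < gap f p0 x.
Proof.
rewrite lt_neqAle gap_ge0 andbT; apply/eqP => gx0.
have [_] := p0P; apply; exists x => // y /=.
have := gap_ge0 y; move: gx0; rewrite /gap linearB; lra.
Qed.

Lemma objectiveE (h : 'Hom(X, R^o)) (mu : R) (x : X) :
  objective f p0 h mu x = gap f p0 x + mu * h x.
Proof.
rewrite /objective /gap /p_ add_lfunE opp_lfunE scale_lfunE.
rewrite opprB; have -> : mu *: h x = mu * h x by [].
lra.
Qed.

Lemma minimizersE (h : 'Hom(X, R^o)) (mu : R) :
  minimizers f p0 h mu = argmin setT (fun x => gap f p0 x + mu * h x).
Proof. by rewrite /minimizers; congr argmin; apply/funext => x; exact: objectiveE. Qed.

Context (Psi_fin : forall u : X, unit_sphere u -> Psi f p0 u \is a fin_num).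
Context (Psi_cont : {within unit_sphere, continuous (Psi f p0)}).
Context (U_neq0 : Psi_zero f p0 !=set0).
Context (nu : R) (nu_gt0 : 0 < nu) (kappa : X -> R).
Context (kappa_gt0 : forall u : X, unit_sphere u -> 0 < kappa u).
Context (kappa_cont : {within unit_sphere, continuous kappa}).
Context (g_expansion :
       ereal_sup [set (`| r `^ nu * (gap f p0 (r *: u) - r * fine (Psi f p0 u))
                          - kappa u |)%:E | u in unit_sphere]
         @[r --> +oo] --> 0%E).
Context (h : 'Hom(X, R^o)) (h_gt0 : forall u : X, Psi_zero f p0 u -> 0 < h u).

Local Notation psi u := (fine (Psi f p0 u)).
Local Notation alpha := (nu / (nu + 1)).
Local Notation beta := (nu + 1)^-1.

(** * Recession slopes on the unit sphere and coercivity *)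

Lemma psi_continuous : {within unit_sphere, continuous (fun u => psi u)}.
Proof.
move/subspace_continuousP: Psi_cont => Pc; apply/subspace_continuousP => u Su.
by apply: fine_cvg; rewrite fineK; [exact: Pc|exact: Psi_fin].
Qed.

Lemma Psi_zeroE u : Psi_zero f p0 u <-> unit_sphere u /\ psi u = 0.
Proof.
split=> -[Su]; first by move=> ->.
by move=> p0'; split => //; rewrite -(fineK (Psi_fin u Su)) p0'.
Qed.

Lemma expansion_uniform (e : R) : 0 < e -> \forall r \near +oo,
  forall u, unit_sphere u ->
    `| r `^ nu * (gap f p0 (r *: u) - r * psi u) - kappa u | <= e.
Proof.
move=> e0; pose s r := ereal_sup [set (`| r `^ nu *
  (gap f p0 (r *: u) - r * psi u) - kappa u |)%:E | u in unit_sphere].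
have H : \forall r \near +oo, (s r < e%:E)%E.
  apply: (g_expansion [set y : \bar R | (y < e%:E)%E]).
  by apply: open_nbhs_nbhs; split; [exact: open_ereal_lt_ereal|rewrite /= lte_fin].
apply: filterS H => r sr u Su; rewrite -lee_fin; apply: ltW; apply: le_lt_trans sr.
by apply: ereal_sup_ubound; exists u.
Qed.

(** As the gap is nonnegative, a negative slope would give a deviation of at least [- r psi u],
    which grows linearly in [r]; for [r >= 1] the factor [r^nu] only enlarges it, against its bound
    [kappa u + 1]. *)
Lemma psi_ge0 u : unit_sphere u -> 0 <= psi u.
Proof.
move=> Su; rewrite leNgt; apply/negP => p_lt0.
have k0 := kappa_gt0 u Su.
have ex := expansion_uniform _ ltr01.
have /filter_ex[r] : \forall r \near +oo, [/\ 1 <= r, (kappa u + 1) / - psi u < r &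
    `| r `^ nu * (gap f p0 (r *: u) - r * psi u) - kappa u | <= 1].
  near=> r; split; [| |by near: r; apply: filterS ex => r; apply].
    by near: r; exact: nbhs_pinfty_ge.
  by near: r; apply: nbhs_pinfty_gt; exact: num_real.
move=> [r1]; rewrite ltr_pdivrMr ?oppr_gt0// => rbig.
have g0 := gap_ge0 (r *: u).
have rn1 : 1 <= r `^ nu by rewrite -(powRr0 r) ler_powR// ltW.
rewrite ler_norml => /andP[_]; apply/negP; rewrite -ltNge.
have h1 : r * - psi u <= gap f p0 (r *: u) - r * psi u by lra.
have h2 : 0 < r * - psi u by lra.
have : gap f p0 (r *: u) - r * psi u <= r `^ nu * (gap f p0 (r *: u) - r * psi u).
  by rewrite ler_peMl//; lra.
lra.
Unshelve. all: end_near. Qed.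

Lemma sphere_neq0 : (@unit_sphere R X) !=set0.
Proof. by have [u [Su _]] := U_neq0; exists u. Qed.

(** The tolerance in the uniform expansion is the minimum of [kappa] on the sphere, so the scaled
    deviation cannot become negative. *)
Lemma gap_ge_slope : \forall r \near +oo, forall u, unit_sphere u ->
  r * psi u <= gap f p0 (r *: u).
Proof.
have [c cS hc] := compact_EVT_min sphere_neq0 unit_sphere_compact kappa_cont.
have k0 : 0 < kappa c by apply: kappa_gt0; rewrite inE in cS.
near=> r => u Su.
have r0 : 0 < r by near: r; apply: nbhs_pinfty_gt; exact: num_real.
have : forall u, unit_sphere u ->
      `| r `^ nu * (gap f p0 (r *: u) - r * psi u) - kappa u | <= kappa c.
  by near: r; exact: expansion_uniform.
move=> /(_ u Su); rewrite ler_norml => /andP[+ _].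
have := hc u (mem_set Su) => kuc lo.
have : 0 <= r `^ nu * (gap f p0 (r *: u) - r * psi u) by lra.
by rewrite pmulr_rge0 ?powR_gt0// subr_ge0.
Unshelve. all: end_near. Qed.

(** Only directions with [h u <= 0] are dangerous. They form a compact set disjoint from the zero
    set of [Psi], so [psi] has a positive minimum there, which beats [mu |h u| <= mu C] for
    [mu < psi c / C]. *)
Lemma slope_gt0 : exists2 mu0 : R, 0 < mu0 & forall mu, 0 < mu < mu0 ->
  forall u, unit_sphere u -> 0 < psi u + mu * h u.
Proof.
pose N : set X := unit_sphere `&` [set u | h u <= 0].
have cN : compact N.
  apply: compact_closedI; first exact: unit_sphere_compact.
  apply: (@closed_comp _ _ (h : X -> R) [set r | r <= 0]) => // x _.
  exact: linear_functional_continuous.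
have [N0|/set0P N0] := eqVneq N set0.
  exists 1 => // mu /andP[mu0 _] u Su; apply: ltr_wpDl; first exact: psi_ge0.
  rewrite mulr_gt0// ltNge; apply/negP => hu.
  by have : N u by []; rewrite N0.
have pN : {within N, continuous (fun u => psi u)}.
  apply: continuous_subspaceW psi_continuous; exact: subIsetl.
have [c] := compact_EVT_min N0 cN pN; rewrite inE => -[Sc hc0] hc.
have c0 : 0 < psi c.
  rewrite lt_neqAle psi_ge0// andbT; apply/eqP => pc0.
  have /h_gt0 : Psi_zero f p0 c by apply/Psi_zeroE.
  by rewrite ltNge hc0.
have [C C0 hC] := linear_functional_bounded h.
exists (psi c / C); first exact: divr_gt0.
move=> mu /andP[mu0]; rewrite ltr_pdivlMr// => muC u Su.
have [hu|hu] := leP (h u) 0; last first.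
  by apply: ltr_wpDl; [exact: psi_ge0|exact: mulr_gt0].
have h1 : psi c <= psi u by apply: hc; rewrite inE.
have := hC u; rewrite Su mulr1 ler_norml => /andP[h2 _].
have h3 : mu * - C <= mu * h u by rewrite ler_wpM2l// ltW.
lra.
Qed.

Lemma sphere_mul (x : X) : x != 0 -> x = `|x| *: (`|x|^-1 *: x).
Proof. by move=> x0; rewrite scalerA divff ?scale1r// normr_eq0. Qed.

(** The perturbed slope has a positive minimum [d] on the sphere, and [gap_ge_slope] then bounds the
    function below by [d |x|] far from the origin. *)
Lemma perturbed_coercive mu : 0 < mu ->
  (forall u, unit_sphere u -> 0 < psi u + mu * h u) ->
  coercive (fun x : X => gap f p0 x + mu * h x).
Proof.
move=> mu0 sl.
have sc : {within unit_sphere, continuous (fun u => psi u + mu * h u)}.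
  apply/subspace_continuousP => u Su; apply: cvgD.
    by move/subspace_continuousP: psi_continuous; apply.
  apply: cvgMl_tmp; apply: cvg_within_filter.
  exact: linear_functional_continuous.
have [c cS hc] := compact_EVT_min sphere_neq0 unit_sphere_compact sc.
set d := psi c + mu * h c in hc.
have d0 : 0 < d by apply: sl; rewrite inE in cS.
move=> A.
have [B [_ hB]] : \forall r \near +oo, [/\ 0 < r, A / d < r &
    forall u, unit_sphere u -> r * psi u <= gap f p0 (r *: u)].
  near=> r; split; near: r.
  - by apply: nbhs_pinfty_gt; exact: num_real.
  - by apply: nbhs_pinfty_gt; exact: num_real.
  - exact: gap_ge_slope.
exists B => x /hB[x0]; rewrite ltr_pdivrMr// => Ax hx.
have xn0 : x != 0 by rewrite -normr_gt0.
have Su := unit_sphere_normalize _ xn0.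
have := hx _ Su; rewrite -sphere_mul// => h1.
have h2 := hc _ (mem_set Su).
have h3 : `|x| * d <= `|x| * psi (`|x|^-1 *: x) + mu * h x.
  have -> : h x = `|x| * h (`|x|^-1 *: x) by rewrite {1}(sphere_mul _ xn0) linearZ.
  by rewrite mulrCA -mulrDr ler_wpM2l.
lra.
Unshelve. all: end_near. Qed.

Lemma perturbed_continuous mu : continuous (fun x : X => gap f p0 x + mu * h x).
Proof.
move=> x; apply: cvgD; first exact: gap_continuous.
by apply: cvgMl_tmp; exact: linear_functional_continuous.
Qed.

(** * The limiting functional [M] on the zero set of [Psi] *)

Lemma Psi_zero_compact : compact (Psi_zero f p0).
Proof.
have -> : Psi_zero f p0 = unit_sphere `&` (fun u => psi u) @^-1` [set 0].
  apply/seteqP; split => u; first by move=> /Psi_zeroE.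
  by move=> ?; apply/Psi_zeroE.
have cS := @unit_sphere_closed R X.
apply: subclosed_compact _ unit_sphere_compact (@subIsetl _ _ _).
rewrite setIC closed_setIS//.
apply: (@closed_comp (subspace unit_sphere) _ (fun u => psi u) [set 0]) => // u _.
exact: psi_continuous.
Qed.

Lemma M_continuous : {within Psi_zero f p0, continuous (M h nu kappa)}.
Proof.
apply/subspace_continuousP => u Uu.
have Su : unit_sphere u by case: Uu.
apply: cvgM; apply: cvg_powR; [exact: kappa_gt0| |exact: h_gt0|].
  have : {within Psi_zero f p0, continuous kappa}.
    by apply: continuous_subspaceW kappa_cont => x [].
  by move/subspace_continuousP; apply.
by apply: cvg_within_filter; exact: linear_functional_continuous.
Qed.

Lemma M_gt0 u : Psi_zero f p0 u -> 0 < M h nu kappa u.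
Proof.
move=> Uu; rewrite mulr_gt0// powR_gt0//; last exact: h_gt0.
by apply: kappa_gt0; case: Uu.
Qed.

Lemma M_star_le u : Psi_zero f p0 u -> M_star f p0 h nu kappa <= M h nu kappa u.
Proof.
move=> Uu; apply: ge_inf; last by exists u.
by exists 0 => _ [v Uv <-]; exact/ltW/M_gt0.
Qed.

Lemma M_star_attained :
  exists2 u, Psi_zero f p0 u & M h nu kappa u = M_star f p0 h nu kappa.
Proof.
have [c] := compact_EVT_min U_neq0 Psi_zero_compact M_continuous.
rewrite inE => Uc hc; exists c => //; apply/eqP.
rewrite eq_le M_star_le// andbT; apply: lb_le_inf; first by exists (M h nu kappa c), c.
by move=> _ [v Uv <-]; apply: hc; rewrite inE.
Qed.

Lemma M_star_gt0 : 0 < M_star f p0 h nu kappa.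
Proof. by have [u Uu <-] := M_star_attained; exact: M_gt0. Qed.

Lemma U_starP u : Psi_zero f p0 u -> M h nu kappa u <= M_star f p0 h nu kappa ->
  U_star f p0 h nu kappa u.
Proof. by move=> Uu Mu; split => // v /M_star_le; exact: le_trans. Qed.

Lemma U_star_M u : U_star f p0 h nu kappa u -> M h nu kappa u = M_star f p0 h nu kappa.
Proof.
move=> [Uu hu]; apply/eqP; rewrite eq_le M_star_le// andbT.
by have [v Uv <-] := M_star_attained; exact: hu.
Qed.

(** * Asymptotics of the minimal value and of the minimizers *)

Lemma trial_upper_bound (e : R) : 0 < e -> \forall mu \near 0^'+,
  exists y : X, gap f p0 y + mu * h y <=
    mu `^ alpha * (C_ nu * M_star f p0 h nu kappa + e).
Proof.
move=> e0; have [u Uu Mu] := M_star_attained; have [Su pu] := (Psi_zeroE u).1 Uu.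
have k0 := kappa_gt0 u Su; have h0 := h_gt0 u Uu.
(* The optimal rescaled radius for [K = kappa u] and [W = h u]; the trial point is
   [t mu^(-1/(nu+1)) u]. *)
pose t := (nu * kappa u / h u) `^ beta.
have t0 : 0 < t by rewrite powR_gt0// divr_gt0// mulr_gt0.
(* The deviation enters the rescaled objective with the factor [t^(-nu)], which this tolerance
   compensates. *)
have e'0 : 0 < e * t `^ nu by rewrite mulr_gt0// powR_gt0.
have b0 : 0 < beta by rewrite invr_gt0 addr_gt0.
have ry : t * mu `^ (- beta) @[mu --> 0^'+] --> +oo.
  exact: gt0_cvgMry t0 (powR_cvgry _ b0).
have ex := ry _ (expansion_uniform _ e'0).
near=> mu; have mu0 : 0 < mu by near: mu; exact: nbhs_right_gt.
pose r := t * mu `^ (- beta).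
have r0 : 0 < r by rewrite mulr_gt0// powR_gt0.
exists (r *: u).
have : `| r `^ nu * (gap f p0 (r *: u) - r * psi u) - kappa u | <= e * t `^ nu.
  by rewrite /r; move: (u) Su; near: mu; exact: ex.
rewrite ler_norml => /andP[_]; rewrite lerBlDr => gle.
rewrite [leRHS]mulrC -ler_pdivrMr ?powR_gt0//.
have -> : h (r *: u) = r * h u by rewrite linearZ.
rewrite -(rescaled_objective _ _ _ _ (psi u))// pu mul0r add0r.
have -> : mu `^ beta * r = t.
  by rewrite /r mulrCA -powRD ?subrr ?powRr0 ?mulr1// (gt_eqF mu0) implybT.
rewrite -Mu -(profile_min _ _ _ nu_gt0 k0 h0) -/t [leRHS]addrAC lerD2r.
have -> : e = t `^ (- nu) * (e * t `^ nu).
  by rewrite powRN mulrCA mulVf ?mulr1// gt_eqF// powR_gt0.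
by rewrite -mulrDr (ler_pM2l (powR_gt0 _ t0)); move: gle; rewrite pu [leRHS]addrC.
Unshelve. all: end_near. Qed.

(** On a ball the gap has a positive minimum, whereas the trial bound and the size of [mu h] there
    both tend to [0]; hence no minimizer can stay in the ball. *)
Lemma minimizer_large (B : R) : \forall mu \near 0^'+,
  forall x, minimizers f p0 h mu x -> B < `|x|.
Proof.
pose K : set X := [set x | `|x| <= B].
have [K0|/set0P K0] := eqVneq K set0.
  near=> mu => x _; rewrite ltNge; apply/negP => xB.
  by have : K x by []; rewrite K0.
have [c _ hc] := compact_EVT_min K0 (closed_ball_compact B)
  (continuous_subspaceT gap_continuous).
have [C C0 hC] := linear_functional_bounded h.
set A := C_ nu * M_star f p0 h nu kappa + 1.
have a0 : 0 < alpha by rewrite divr_gt0 ?addr_gt0.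
have lim0 : mu `^ alpha * A + mu * (C * B) @[mu --> 0^'+] --> 0 * A + 0 * (C * B).
  apply: cvgD; apply: cvgMr_tmp; first exact: powR_cvg0.
  by apply: cvg_at_right_filter; exact: cvg_id.
rewrite !mul0r addr0 in lim0.
near=> mu => x; rewrite minimizersE => -[_ xmin].
have mu0 : 0 < mu by near: mu; exact: nbhs_right_gt.
rewrite ltNge; apply/negP => xB.
have h1 : gap f p0 c <= gap f p0 x by apply: hc; rewrite inE.
have h2 : mu `^ alpha * A + mu * (C * B) < gap f p0 c.
  by near: mu; exact: cvgr_lt lim0 _ (gap_gt0 c).
have [y hy] : exists y, gap f p0 y + mu * h y <= mu `^ alpha * A.
  by near: mu; exact: trial_upper_bound.
have h3 := xmin y I.
have h4 : mu * - (C * B) <= mu * h x.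
  rewrite ler_pM2l// lerNl.
  have /le_trans := ler_norm (- h x); apply; rewrite normrN.
  by apply: le_trans (hC x) _; rewrite ler_pM2l.
lra.
Unshelve. all: end_near. Qed.

(** The filter is general because the statement is applied both to sequences and to ultrafilters.
    Only convergence of the directions is assumed; that the limit lies in [U_star] is a
    conclusion. *)
Lemma minimizer_limits (F : set_system R) (FF : ProperFilter F) (x : R -> X)
    (ubar : X) (u := fun mu => `|x mu|^-1 *: x mu) :
  F --> 0^'+ -> (\forall mu \near F, minimizers f p0 h mu (x mu)) ->
  u mu @[mu --> F] --> ubar ->
  [/\ U_star f p0 h nu kappa ubar,
      psi (u mu) / mu @[mu --> F] --> (0 : R),
      (gap f p0 (x mu) + mu * h (x mu)) / mu `^ alpha @[mu --> F] -->
        C_ nu * M_star f p0 h nu kappa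
    & mu `^ beta * `|x mu| @[mu --> F] --> (nu * kappa ubar / h ubar) `^ beta].
Proof.
move=> F0 xmin uF.
have mu0F : \forall mu \near F, 0 < mu by apply: F0; exact: nbhs_right_gt.
have rF (B : R) : \forall mu \near F, B < `|x mu|.
  have := F0 _ (minimizer_large B).
  by apply: filterS2 xmin => mu xm; apply.
have ry : `|x mu| @[mu --> F] --> +oo by apply/cvgryPgt.
have xE : \forall mu \near F, x mu = `|x mu| *: u mu.
  by apply: filterS (rF 0) => mu; rewrite normr_gt0 => /sphere_mul.
have uS : \forall mu \near F, unit_sphere (u mu).
  by apply: filterS (rF 0) => mu; rewrite normr_gt0 => /unit_sphere_normalize.
have cS := @unit_sphere_closed R X.
have Sb : unit_sphere ubar by exact: closed_cvg uF.
have pF : psi (u mu) @[mu --> F] --> psi ubar.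
  exact: (cvg_within_continuous _ (fun v => psi v)) psi_continuous Sb uS uF.
have kF : kappa (u mu) @[mu --> F] --> kappa ubar.
  exact: cvg_within_continuous kappa_cont Sb uS uF.
have hF : h (u mu) @[mu --> F] --> h ubar.
  by apply: (cvg_comp _ _ uF); exact: linear_functional_continuous.
have kb := kappa_gt0 _ Sb.
pose K mu := `|x mu| `^ nu * (gap f p0 (x mu) - `|x mu| * psi (u mu)).
pose W mu := psi (u mu) / mu + h (u mu).
pose t mu := mu `^ beta * `|x mu|.
pose V mu := t mu `^ (- nu) * K mu + t mu * W mu.
have C0 := C_gt0 _ nu_gt0.
have a0 : 0 < alpha by rewrite divr_gt0 ?addr_gt0.
(* Uniformity of the expansion over the sphere lets the direction [u mu] move with [mu]. *)
have KF : K mu @[mu --> F] --> kappa ubar.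
  have dF : K mu - kappa (u mu) @[mu --> F] --> (0 : R).
    apply/cvgr0Pnorm_le => e e0.
    have ex := ry _ (expansion_uniform _ e0).
    near=> mu.
    have -> : K mu = `|x mu| `^ nu *
        (gap f p0 (`|x mu| *: u mu) - `|x mu| * psi (u mu)).
      by rewrite /K; congr (_ * (gap _ _ _ - _)); near: mu.
    have Su : unit_sphere (u mu) by near: mu.
    by move: (u mu) Su; near: mu; exact: ex.
  have -> : K = (fun mu => (K mu - kappa (u mu)) + kappa (u mu)).
    by apply/funext => mu; rewrite subrK.
  by rewrite -[kappa ubar]add0r; exact: cvgD.
have K0F : \forall mu \near F, 0 < K mu by exact: cvgr_gt KF _ kb.
have t0F : \forall mu \near F, 0 < t mu.
  by apply: filterS2 mu0F (rF 0) => mu m0 r0; rewrite mulr_gt0 ?powR_gt0.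
have muWE : \forall mu \near F, psi (u mu) + mu * h (u mu) = mu * W mu.
  by apply: filterS mu0F => mu m0; rewrite /W mulrDr mulrCA divff ?mulr1// gt_eqF.
(* Until [ubar] is known to lie in the zero set of [Psi], [h (u mu)] may be negative, so positivity
   of [W] is taken from [slope_gt0]. *)
have W0F : \forall mu \near F, 0 < W mu.
  have [mu1 mu10 sl] := slope_gt0.
  have muF : \forall mu \near F, mu < mu1 by apply: F0; exact: nbhs_right_lt.
  near=> mu; have m0 : 0 < mu by near: mu.
  rewrite -(pmulr_rgt0 _ m0).
  have <- : psi (u mu) + mu * h (u mu) = mu * W mu by near: mu.
  apply: sl; last by near: mu.
  by rewrite m0/=; near: mu.
have VE : \forall mu \near F,
    V mu = (gap f p0 (x mu) + mu * h (x mu)) / mu `^ alpha.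
  near=> mu; rewrite /V /t /K /W rescaled_objective//; try by near: mu.
  have -> : h (x mu) = `|x mu| * h (u mu); last by [].
  have {1}-> : x mu = `|x mu| *: u mu by near: mu.
  by rewrite linearZ.
have Vub (e : R) : 0 < e ->
    \forall mu \near F, V mu <= C_ nu * M_star f p0 h nu kappa + e.
  move=> e0; near=> mu.
  have -> : V mu = (gap f p0 (x mu) + mu * h (x mu)) / mu `^ alpha by near: mu.
  rewrite ler_pdivrMr; last by apply: powR_gt0; near: mu.
  rewrite [leRHS]mulrC.
  have [y hy] : exists y : X, gap f p0 y + mu * h y <=
      mu `^ alpha * (C_ nu * M_star f p0 h nu kappa + e).
    by near: mu; apply: F0; exact: trial_upper_bound.
  apply: le_trans hy.
  have : minimizers f p0 h mu (x mu) by near: mu.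
  by rewrite minimizersE => -[_]; apply.
have young : \forall mu \near F, C_ nu * (K mu `^ beta * W mu `^ alpha) <= V mu.
  by near=> mu; apply: young_profile => //; near: mu.
(* As [W] may be unbounded, Young's bound is multiplied by [mu^(nu/(nu+1))], which replaces [W] by
   the convergent [mu W = psi + mu h]. If [psi ubar] were positive, the left side would keep a
   positive limit while the upper bound tends to [0]. *)
have pb : psi ubar = 0.
  apply/eqP; rewrite eq_le psi_ge0// andbT leNgt; apply/negP => pb.
  have muF : mu @[mu --> F] --> (0 : R).
    by apply: cvg_trans F0 _; apply: cvg_at_right_filter; exact: cvg_id.
  have L1 : C_ nu * (K mu `^ beta * (psi (u mu) + mu * h (u mu)) `^ alpha) @[mu --> F]
      --> C_ nu * (kappa ubar `^ beta * (psi ubar + 0 * h ubar) `^ alpha).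
    apply: cvgMl_tmp; apply: cvgM; apply: cvg_powR => //.
      by rewrite mul0r addr0.
    by apply: cvgD => //; exact: cvgM.
  have L2 : mu `^ alpha * (C_ nu * M_star f p0 h nu kappa + 1) @[mu --> F] -->
      0 * (C_ nu * M_star f p0 h nu kappa + 1).
    apply: cvgMr_tmp.
    exact: cvg_trans (cvg_app (fun mu : R => mu `^ alpha) F0) (powR_cvg0 a0).
  suff L12 : \forall mu \near F,
      C_ nu * (K mu `^ beta * (psi (u mu) + mu * h (u mu)) `^ alpha) <=
      mu `^ alpha * (C_ nu * M_star f p0 h nu kappa + 1).
    have := ler_cvg_to L1 L2 L12; rewrite mul0r addr0 mul0r leNgt.
    by rewrite (mulr_gt0 C0 (mulr_gt0 (powR_gt0 _ kb) (powR_gt0 _ pb))) => /(_ FF).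
  near=> mu.
  have -> : psi (u mu) + mu * h (u mu) = mu * W mu by near: mu.
  have m0 : 0 < mu by near: mu.
  have W0 : 0 < W mu by near: mu.
  rewrite (powRM _ (ltW m0) (ltW W0)) [_ `^ beta * _]mulrCA [leLHS]mulrCA.
  rewrite (ler_pM2l (powR_gt0 _ m0)).
  apply: (@le_trans _ _ (V mu)); first by near: mu.
  by near: mu; exact: Vub.
have Ub : Psi_zero f p0 ubar by apply/Psi_zeroE.
have hb := h_gt0 _ Ub.
have hW : \forall mu \near F, 0 < h (u mu) <= W mu.
  near=> mu; apply/andP; split; first by near: mu; exact: cvgr_gt hF _ hb.
  have m0 : 0 < mu by near: mu.
  rewrite /W lerDr divr_ge0 ?(ltW m0)// psi_ge0//; near: mu; exact: uS.
have lowW : \forall mu \near F, C_ nu * (K mu `^ beta * h (u mu) `^ alpha) <=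
    C_ nu * (K mu `^ beta * W mu `^ alpha).
  near=> mu; have /andP[h0 hw] : 0 < h (u mu) <= W mu by near: mu.
  have K0 : 0 < K mu by near: mu.
  rewrite ler_pM2l// ler_pM2l ?powR_gt0// ge0_ler_powR ?nnegrE//.
  - exact: ltW.
  - exact: ltW.
  - exact: le_trans (ltW h0) hw.
have L3 : C_ nu * (K mu `^ beta * h (u mu) `^ alpha) @[mu --> F] -->
    C_ nu * M h nu kappa ubar.
  by apply: cvgMl_tmp; apply: cvgM; exact: cvg_powR.
have Mub : M h nu kappa ubar <= M_star f p0 h nu kappa.
  rewrite -(ler_pM2l C0); apply/ler_addgt0Pr => e e0.
  apply: (cvgr_to_le L3); near=> mu.
  apply: (@le_trans _ _ (C_ nu * (K mu `^ beta * W mu `^ alpha))); first by near: mu.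
  apply: (@le_trans _ _ (V mu)); first by near: mu.
  by near: mu; exact: Vub.
have Us := U_starP _ Ub Mub.
have ME := U_star_M _ Us.
rewrite ME in L3.
have VF : V mu @[mu --> F] --> C_ nu * M_star f p0 h nu kappa.
  apply/cvgrPdist_le => e e0; near=> mu.
  rewrite ler_distlC; apply/andP; split; last by near: mu; exact: Vub.
  apply: (@le_trans _ _ (C_ nu * (K mu `^ beta * h (u mu) `^ alpha))).
    near: mu; apply: cvgr_ge L3 _ _; by rewrite ltrBlDr ltrDl.
  apply: (@le_trans _ _ (C_ nu * (K mu `^ beta * W mu `^ alpha))); near: mu; exact.
(* The optimal value is squeezed between its version with [h] in place of [W] and the actual value.
   Dividing out the known limit of [K] and inverting the power gives [W --> h ubar], which amounts
   to [psi / mu --> 0]. *)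
have QF : C_ nu * (K mu `^ beta * W mu `^ alpha) @[mu --> F] -->
    C_ nu * M_star f p0 h nu kappa.
  by apply: squeeze_cvgr L3 VF; apply: filterS2 lowW young => mu -> ->.
have WaF : W mu `^ alpha @[mu --> F] --> h ubar `^ alpha.
  have -> : h ubar `^ alpha =
      C_ nu * M_star f p0 h nu kappa / (C_ nu * kappa ubar `^ beta).
    rewrite -ME /M mulrA mulrAC divff ?mul1r// mulf_neq0 ?gt_eqF ?powR_gt0//.
  apply: cvg_trans (cvgM QF (cvgV _ (cvgMl_tmp (cvg_powR _ _ _ kb KF)))); last first.
    by rewrite mulf_neq0 ?gt_eqF ?powR_gt0.
  apply: near_eq_cvg; near=> mu => /=.
  have K0 : 0 < K mu by near: mu.
  by rewrite mulrA mulrAC divff ?mul1r// mulf_neq0 ?gt_eqF ?powR_gt0.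
have WF : W mu @[mu --> F] --> h ubar.
  have hE : h ubar = (h ubar `^ alpha) `^ alpha^-1.
    by rewrite -powRrM divff ?gt_eqF// powRr1// ltW.
  have H : (W mu `^ alpha) `^ alpha^-1 @[mu --> F] --> h ubar.
    by rewrite hE; apply: cvg_powR => //; exact: powR_gt0.
  apply: cvg_trans H; apply: near_eq_cvg; near=> mu.
  have W0 : 0 < W mu by near: mu.
  by rewrite -powRrM divff ?gt_eqF// powRr1// ltW.
split => //.
- have -> : (fun mu => psi (u mu) / mu) = (fun mu => W mu - h (u mu)).
    by apply/funext => mu; rewrite /W addrK.
  by rewrite -(subrr (h ubar)); exact: cvgB.
- by apply: cvg_trans VF; apply: near_eq_cvg.
- by apply: (profile_stable _ _ _ _ _ _ nu_gt0 kb hb t0F KF WF); rewrite -ME in VF.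
Unshelve. all: end_near. Qed.

End Perturbation.

(** * Limits for the whole family and along sequences *)

Theorem theorem4p3 (R : realType) (X : normedVectType R)
    (Xneq0 : (0 < \dim {:X})%N)
    (f : X -> R) (f_convex : convex_function [set: X] f)
    (p0 : 'Hom(X, R^o)) (p0P : (dom_fenchel f `\` ran_subdiff f) p0)
    (Psi_fin : forall u : X, unit_sphere u -> Psi f p0 u \is a fin_num)
    (Psi_cont : {within unit_sphere, continuous (Psi f p0)})
    (U_neq0 : Psi_zero f p0 !=set0)
    (nu : R) (nu_gt0 : 0 < nu)
    (kappa : X -> R)
    (kappa_gt0 : forall u : X, unit_sphere u -> 0 < kappa u)
    (kappa_cont : {within unit_sphere, continuous kappa})
    (g_expansion :
       ereal_sup [set (`| r `^ nu * (gap f p0 (r *: u) - r * fine (Psi f p0 u))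
                          - kappa u |)%:E | u in unit_sphere]
         @[r --> +oo] --> 0%E)
    (h : 'Hom(X, R^o)) (h_gt0 : forall u : X, Psi_zero f p0 u -> 0 < h u) :
  [/\ forall mu : R, 0 < mu ->
        minval f p0 h mu
        = ereal_inf [set (gap f p0 x + mu * h x)%:E | x in [set: X]],
      exists2 mu0 : R, 0 < mu0 & forall mu : R, 0 < mu < mu0 ->
        [/\ coercive (fun x : X => gap f p0 x + mu * h x),
            minimizers f p0 h mu !=set0
          & compact (minimizers f p0 h mu)],
      exists2 u : X, Psi_zero f p0 u & M h nu kappa u = M_star f p0 h nu kappa,
      equiv0 (fun mu => fine (minval f p0 h mu))
        (fun mu => C_ nu * M_star f p0 h nu kappa * mu `^ (nu / (nu + 1)))
    & forall x_ : R -> X,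
        (\forall mu \near 0^'+, minimizers f p0 h mu (x_ mu)) ->
        let r_ (mu : R) : R := `|x_ mu| in
        let u_ (mu : R) : X := (r_ mu)^-1 *: x_ mu in
        let rlim (u : X) : R := (nu * kappa u / h u) `^ (nu + 1)^-1 in
        let Ustar : set X := U_star f p0 h nu kappa in
        [/\ \forall mu \near 0^'+, x_ mu != 0,
            edist_inf Ustar (u_ mu) @[mu --> 0^'+] --> 0%E,
            fine (Psi f p0 (u_ mu)) / mu @[mu --> 0^'+] --> (0 : R),
            forall mu_ : nat -> R,
              (forall j, 0 < mu_ j) -> mu_ j @[j --> \oo] --> (0 : R) ->
              (exists (s : nat -> nat) (ubar : X),
                 [/\ {homo s : i j / (i < j)%N}, Ustar ubar
                   & u_ (mu_ (s j)) @[j --> \oo] --> ubar]) /\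
              (forall (s : nat -> nat) (ubar : X),
                 {homo s : i j / (i < j)%N} -> Ustar ubar ->
                 u_ (mu_ (s j)) @[j --> \oo] --> ubar ->
                 mu_ (s j) `^ (nu + 1)^-1 * r_ (mu_ (s j)) @[j --> \oo]
                   --> rlim ubar)
          & forall ustar : X, Ustar = [set ustar] ->
              u_ mu @[mu --> 0^'+] --> ustar /\
              equiv0 r_ (fun mu => rlim ustar * mu `^ (- (nu + 1)^-1))]].
Proof.
pose alpha := nu / (nu + 1); pose beta := (nu + 1)^-1.
have [mu0 mu00 sl] := slope_gt0 f p0 p0P Psi_fin Psi_cont nu nu_gt0 kappa
  kappa_gt0 g_expansion h h_gt0.
have Mat := M_star_attained f p0 Psi_fin Psi_cont U_neq0 nu kappa kappa_gt0
  kappa_cont h h_gt0.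
have Mgt0 := M_star_gt0 f p0 Psi_fin Psi_cont U_neq0 nu kappa kappa_gt0
  kappa_cont h h_gt0.
have lims := minimizer_limits f f_convex p0 p0P Psi_fin Psi_cont U_neq0 nu nu_gt0
  kappa kappa_gt0 kappa_cont g_expansion h h_gt0.
have large := minimizer_large f f_convex p0 p0P Psi_fin Psi_cont U_neq0 nu nu_gt0
  kappa kappa_gt0 kappa_cont g_expansion h h_gt0.
have mins mu : 0 < mu < mu0 ->
    [/\ coercive (fun x : X => gap f p0 x + mu * h x),
      minimizers f p0 h mu !=set0 & compact (minimizers f p0 h mu)].
  move=> mu0mu; have /andP[mugt0 _] := mu0mu.
  have co := perturbed_coercive f p0 Psi_fin Psi_cont U_neq0 nu kappa kappa_gt0
    kappa_cont g_expansion h mu mugt0 (sl mu mu0mu).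
  have [ne cp] := coercive_argmin _
    (perturbed_continuous f f_convex p0 h mu) co.
  by rewrite minimizersE.
(* Along an ultrafilter finer than [0^'+] the directions of the minimizers
   converge, so every limit at [0^'+] reduces to [minimizer_limits]. *)
have ultra (x : R -> X) (G : set_system R) (UG : UltraFilter G) :
    (\forall mu \near 0^'+, minimizers f p0 h mu (x mu)) -> 0^'+ `<=` G ->
    exists2 ubar : X, `|x mu|^-1 *: x mu @[mu --> G] --> ubar &
    [/\ U_star f p0 h nu kappa ubar,
      fine (Psi f p0 (`|x mu|^-1 *: x mu)) / mu @[mu --> G] --> (0 : R),
      (gap f p0 (x mu) + mu * h (x mu)) / mu `^ alpha @[mu --> G] -->
        C_ nu * M_star f p0 h nu kappa
    & mu `^ beta * `|x mu| @[mu --> G] --> (nu * kappa ubar / h ubar) `^ beta].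
  move=> xmin G0.
  have [|ubar _ uG] := @ultra_compact_cvg _ _ G UG unit_sphere
    (fun mu => `|x mu|^-1 *: x mu) unit_sphere_compact.
    apply: G0; apply: filterS2 xmin (large 0) => mu xm /(_ _ xm).
    by rewrite normr_gt0 => /unit_sphere_normalize.
  by exists ubar => //; apply: lims => //; exact: G0.
split => //.
- move=> mu _; rewrite /minval; congr ereal_inf.
  by apply/seteqP; split => _ [x _ <-]; exists x => //; rewrite objectiveE.
- by exists mu0.
(* A selection of minimizers is needed to express [minval]; for [mu] outside [(0, mu0)] the value of
   [get] may be arbitrary, which does not affect the limit. *)
- pose x mu := get (minimizers f p0 h mu).
  have xmin : \forall mu \near 0^'+, minimizers f p0 h mu (x mu).
    near=> mu; have [|_ [y ym] _] := mins mu.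
      by apply/andP; split; near: mu; [exact: nbhs_right_gt|exact: nbhs_right_lt].
    exact: getI ym.
  apply: cvg_ultra => G UG G0.
  have [ubar _ [_ _ VG _]] := ultra x G UG xmin G0.
  have d0 : C_ nu * M_star f p0 h nu kappa != 0.
    by rewrite gt_eqF// mulr_gt0// C_gt0.
  have VG1 : (gap f p0 (x mu) + mu * h (x mu)) / mu `^ alpha /
      (C_ nu * M_star f p0 h nu kappa) @[mu --> G] -->
      C_ nu * M_star f p0 h nu kappa / (C_ nu * M_star f p0 h nu kappa).
    exact: cvgMr_tmp VG.
  rewrite divff// in VG1; apply: cvg_trans VG1; apply: near_eq_cvg.
  apply: filterS (G0 _ xmin) => mu [_ xm].
  have -> : minval f p0 h mu = (objective f p0 h mu (x mu))%:E.
    apply/eqP; rewrite eq_le; apply/andP; split.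
      by apply: ereal_inf_lbound; exists (x mu).
    by apply: le_ereal_inf_tmp => _ [y _ <-]; rewrite lee_fin xm.
  by rewrite /= objectiveE [in RHS]invfM [RHS]mulrA mulrAC.
move=> x xmin r u rlim Ustar; split.
- by apply: filterS2 xmin (large 0) => mu xm /(_ _ xm); rewrite normr_gt0.
- apply: cvg_ultra => G UG G0.
  have [ubar uG [Us _ _ _]] := ultra x G UG xmin G0.
  (* The distance to a set is continuous in the point and vanishes at [ubar], which belongs to the
     set. *)
  rewrite -(edist_inf0 Us); apply: (cvg_comp _ _ uG); exact: edist_inf_continuous.
- apply: cvg_ultra => G UG G0.
  by have [ubar uG [_ + _ _]] := ultra x G UG xmin G0.
- move=> mu_ mupos mulim; split.
    have mu0F := pos_cvg_at_right _ mupos mulim.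
    have uS : \forall j \near \oo, unit_sphere (u (mu_ j)).
      apply: (mu0F [set mu | unit_sphere (u mu)]).
      apply: filterS2 xmin (large 0) => mu xm /(_ _ xm).
      by rewrite normr_gt0 => /unit_sphere_normalize.
    have [ubar [_ cl]] := unit_sphere_compact (u (mu_ j) @[j --> \oo]) _ uS.
    have [s hs us] := cluster_subsequence _ _ cl.
    exists s, ubar; split => //.
    have F0 : mu_ (s j) @[j --> \oo] --> 0^'+.
      exact: (cvg_comp s mu_ (homo_cvg_infty _ hs) mu0F).
    have [] := lims (mu_ (s j) @[j --> \oo]) _ x ubar F0 (F0 _ xmin) us.
    by [].
  move=> s ubar hs Us us.
  have mu0F := pos_cvg_at_right _ mupos mulim.
  have F0 : mu_ (s j) @[j --> \oo] --> 0^'+.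
    exact: (cvg_comp s mu_ (homo_cvg_infty _ hs) mu0F).
  by have [] := lims (mu_ (s j) @[j --> \oo]) _ x ubar F0 (F0 _ xmin) us.
move=> ustar Ustar1; split.
  (* Every ultrafilter limit of the directions lies in [Ustar], so the singleton leaves [ustar] as
     the only possible limit. *)
  apply: cvg_ultra => G UG G0.
  by have [ubar uG []] := ultra x G UG xmin G0; rewrite -/Ustar Ustar1 => /= <-.
apply: cvg_ultra => G UG G0.
have [ubar uG []] := ultra x G UG xmin G0; rewrite -/Ustar Ustar1 => /= -> _ _ rG.
have [Uu _] : Ustar ustar by rewrite Ustar1.
have l0 : rlim ustar != 0.
  rewrite gt_eqF// powR_gt0// divr_gt0 ?h_gt0// mulr_gt0// kappa_gt0//.
  by case: Uu.
have rG1 : mu `^ beta * `|x mu| / rlim ustar @[mu --> G] -->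
    rlim ustar / rlim ustar by exact: cvgMr_tmp rG.
rewrite divff// in rG1; apply: cvg_trans rG1; apply: near_eq_cvg.
near=> mu; rewrite powRN [in RHS]invfM invrK [RHS]mulrCA [LHS]mulrC.
by congr (_ * _); exact: mulrC.
Unshelve. all: end_near. Qed.
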